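(* Let $0<\mu\le L$ and let $f\in C^2(\mathbb{R}^d)$ be convex with $\mu I\preceq\nabla^2f(\mathbf{x})\preceq LI$ for all $\mathbf{x}\in\mathbb{R}^d$, with minimizer $\mathbf{x}_*$. Let $\epsilon>0$, $c:=\frac{2\sqrt{\mu L}}{\mu+L}$, let $\Phi:\mathbb{R}^d\to\mathbb{R}$ be a Legendre function, and let $t\ge2$. Run the finite-difference procedure (defined in the context) from $\mathbf{x}_1\in\mathbb{R}^d$ with admissible stepsizes $\eta_j>0$, and suppose that every performed step satisfies $$\eta_jD_{f,\Omega_{\epsilon,c}}(\mathbf{x}_{j+1}\|\mathbf{x}_j)\le D_\Phi(\mathbf{x}_{j+1}\|\mathbf{x}_j).$$ Let $\widehat{\mathbf{x}}_t$ be the returned point, equal to the first stopping point $\mathbf{x}_\tau$ if one occurs with $\tau\le t$ and to $\mathbf{x}_t$ otherwise. Then $$f(\widehat{\mathbf{x}}_t)-f(\mathbf{x}_* )\le\max\left\{\frac{D_\Phi(\mathbf{x}_*\|\mathbf{x}_1)}{\sum_{j=1}^{t-1}\eta_j},\ \max_{\mathbf{x}:\ \|\mathbf{x}-\mathbf{x}_*\|_2\le\frac{L}{2\mu}(1+\frac1c)\epsilon\sqrt d}\bigl(f(\mathbf{x})-f(\mathbf{x}_* )\bigr)\right\},$$ where the first term is omitted if stopping occurs before it is needed.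
   Context: Let $\mathbf{e}_i$ be the standard basis vectors. For $\epsilon>0$ define $m_i(\mathbf{x}):=\frac{f(\mathbf{x}+\epsilon\mathbf{e}_i)-f(\mathbf{x}-\epsilon\mathbf{e}_i)}{2\epsilon}$, $r_i(\mathbf{x}):=\frac{f(\mathbf{x}+\epsilon\mathbf{e}_i)+f(\mathbf{x}-\epsilon\mathbf{e}_i)-2f(\mathbf{x})}{2\epsilon}$, $M(\mathbf{x}):=\|\mathbf{m}(\mathbf{x})\|_2$, $R(\mathbf{x}):=\|\mathbf{r}(\mathbf{x})\|_2$. For $c\in(0,1]$, $V_{\epsilon,c}:=\{\mathbf{x}:M(\mathbf{x})\le R(\mathbf{x})/c\}$, and for $\mathbf{x}\notin V_{\epsilon,c}$, $\Omega_{\epsilon,c}(\mathbf{x}):=\alpha(\mathbf{x})\mathbf{m}(\mathbf{x})$ with $\alpha(\mathbf{x}):=\frac{c(M(\mathbf{x})^2-R(\mathbf{x})^2)}{M(\mathbf{x})(cM(\mathbf{x})-R(\mathbf{x}))}$. Finite-difference procedure: at iterate $\mathbf{x}_j$, if $\mathbf{x}_j\in V_{\epsilon,c}$ the procedure stops at $\mathbf{x}_j$; otherwise, with a stepsize $\eta_j>0$ that is admissible, i.e. $\nabla\Phi(\mathbf{x}_j)-\eta_j\Omega_{\epsilon,c}(\mathbf{x}_j)\in\operatorname{int}\operatorname{dom}\Phi^*$, it performs the step $\mathbf{x}_{j+1}=\nabla\Phi^*(\nabla\Phi(\mathbf{x}_j)-\eta_j\Omega_{\epsilon,c}(\mathbf{x}_j))$.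 Here $\Phi^*$ is the convex conjugate; for a Legendre function (closed proper convex, essentially smooth, essentially strictly convex) $\nabla\Phi$ is one-to-one with inverse $\nabla\Phi^*$ on $\operatorname{int}\operatorname{dom}\Phi^*$. $D_\Phi(\mathbf{x}\|\mathbf{y})=\Phi(\mathbf{x})-\Phi(\mathbf{y})-\langle\nabla\Phi(\mathbf{y}),\mathbf{x}-\mathbf{y}\rangle$ and $D_{f,\Omega}(\mathbf{x}\|\mathbf{y})=\langle\Omega(\mathbf{y}),\mathbf{y}-\mathbf{x}\rangle-f(\mathbf{y})+f(\mathbf{x})$. ''First term omitted'' means that if the procedure stops at an index $\tau\le t$, so that the sum of stepsizes up to $t-1$ need not be defined, the bound is by the second term alone. *)

(* Defs.v *)
From mathcomp Require Import all_boot all_order all_algebra.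
From mathcomp Require Import all_classical all_reals all_analysis.

Set Implicit Arguments.
Unset Strict Implicit.
Unset Printing Implicit Defensive.

Import Order.TTheory GRing.Theory Num.Theory.
Import numFieldNormedType.Exports.

Local Open Scope classical_set_scope.
Local Open Scope ring_scope.

Section Euclidean.
Context {R : realType} {d : nat}.
Implicit Types (u v x y : 'rV[R]_d) (f : 'rV[R]_d -> R) (A B : 'M[R]_d).

Definition dot u v : R := (u *m v^T) 0 0.

(* The library norm on row vectors is the sup norm; it only serves for the
   topology here. *)
Definition norm2 u : R := Num.sqrt (dot u u).

Definition grad f x : 'rV[R]_d := \row_i 'D_(delta_mx 0 i) f x.

(* [jacobian] acts on row vectors from the right, so entry (i, j) is the i-th
   partial derivative of the j-th partial derivative of f. *)
Definition hessian f x : 'M[R]_d := 'J (grad f) x.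

Definition C2 f : Prop :=
  [/\ forall x, differentiable f x,
      forall x, differentiable (grad f) x
    & continuous (hessian f)].

Definition loewner_le A B : Prop :=
  forall v, (v *m A *m v^T) 0 0 <= (v *m B *m v^T) 0 0.

Definition is_minimizer f x : Prop := forall y, f x <= f y.

Definition is_max_over (D : set 'rV[R]_d) f (b : R) : Prop :=
  (exists2 x, D x & f x = b) /\ forall x, D x -> f x <= b.

End Euclidean.

(* Convex analysis of extended-real-valued functions, after Rockafellar. *)
Section Legendre.
Context {R : realType} {d : nat}.
Implicit Types (F : 'rV[R]_d -> \bar R) (x y g : 'rV[R]_d).

Definition dom F : set 'rV[R]_d := [set x | (F x < +oo)%E].

Definition epigraph F : set ('rV[R]_d * R^o) := [set p | (F p.1 <= p.2%:E)%E].

Definition proper_fun F : Prop :=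
  (exists x, dom F x) /\ forall x, (-oo < F x)%E.

Definition closed_proper_convex F : Prop :=
  [/\ proper_fun F, convex_set (epigraph F) & lower_semicontinuous F].

Definition subdifferential F x : set 'rV[R]_d :=
  [set g | forall y, (F x + (dot g (y - x))%:E <= F y)%E].

(* [fine] only matters outside the interior of the domain: a proper function is
   real-valued on it, and both notions of derivative are local. *)
Definition essentially_smooth F : Prop :=
  [/\ (dom F)° !=set0,
      forall x, (dom F)° x -> differentiable (fine \o F) x
    & forall (u : nat -> 'rV[R]_d) x,
        (forall n, (dom F)° (u n)) ->
        (closure (dom F)° `\` (dom F)°) x ->
        u @ \oo --> x ->
        norm2 (grad (fine \o F) (u n)) @[n --> \oo] --> +oo].

Definition strictly_convex_on (C : set 'rV[R]_d) F : Prop :=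
  forall x y (t : R), C x -> C y -> x != y -> 0 < t < 1 ->
    (F (t *: x + (1 - t) *: y)%R < t%:E * F x + (1 - t)%:E * F y)%E.

Definition essentially_strictly_convex F : Prop :=
  forall C : set 'rV[R]_d, convex_set C ->
    C `<=` [set x | subdifferential F x !=set0] -> strictly_convex_on C F.

Definition legendre F : Prop :=
  [/\ closed_proper_convex F, essentially_smooth F
    & essentially_strictly_convex F].

Definition conjugate F (u : 'rV[R]_d) : \bar R :=
  ereal_sup [set ((dot u x)%:E - F x)%E | x in [set: 'rV[R]_d]].

End Legendre.

Section Divergences.
Context {R : realType} {d : nat}.
Implicit Types (f Phi : 'rV[R]_d -> R) (x y : 'rV[R]_d).

Definition bregman Phi x y : R := Phi x - Phi y - dot (grad Phi y) (x - y).

Definition div_with f (Om : 'rV[R]_d -> 'rV[R]_d) x y : R :=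
  dot (Om y) (y - x) - f y + f x.

End Divergences.

Section FiniteDifferences.
Context {R : realType} {d : nat}.
Variables (f : 'rV[R]_d -> R) (eps : R).
Implicit Types (x : 'rV[R]_d) (c : R).

Definition fd_m x : 'rV[R]_d :=
  \row_i ((f (x + eps *: delta_mx 0 i) - f (x - eps *: delta_mx 0 i))
          / (2 * eps)).

Definition fd_r x : 'rV[R]_d :=
  \row_i ((f (x + eps *: delta_mx 0 i) + f (x - eps *: delta_mx 0 i) - 2 * f x)
          / (2 * eps)).

Definition fd_M x : R := norm2 (fd_m x).
Definition fd_R x : R := norm2 (fd_r x).

Definition fd_V c : set 'rV[R]_d := [set x | fd_M x <= fd_R x / c].

Definition fd_alpha c x : R :=
  c * (fd_M x ^+ 2 - fd_R x ^+ 2) / (fd_M x * (c * fd_M x - fd_R x)).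

Definition fd_Omega c x : 'rV[R]_d := fd_alpha c x *: fd_m x.

End FiniteDifferences.

(* Iterates and stepsizes are total sequences indexed from 1; their values at
   index 0 and past the first stopping index are irrelevant. *)
Section Procedure.
Context {R : realType} {d : nat}.
Implicit Types (V : set 'rV[R]_d) (x : nat -> 'rV[R]_d) (eta : nat -> R).

Definition stops_by V x (t : nat) : bool := has (fun j => x j \in V) (iota 1 t).

Definition performed_step V x (t j : nat) : Prop :=
  (1 <= j < t)%N /\ ~~ stops_by V x j.

Definition returned_point V x (t : nat) : 'rV[R]_d :=
  x (head t [seq j <- iota 1 t | x j \in V]).

Definition dual_point (Phi : 'rV[R]_d -> R) (Om : 'rV[R]_d -> 'rV[R]_d)
    (eta : R) (x : 'rV[R]_d) : 'rV[R]_d := grad Phi x - eta *: Om x.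

Definition admissible Phi Om (eta : R) (x : 'rV[R]_d) : Prop :=
  0 < eta /\ (dom (conjugate (EFin \o Phi)))° (dual_point Phi Om eta x).

Definition mirror_step Phi Om (eta : R) (x : 'rV[R]_d) : 'rV[R]_d :=
  grad (fine \o conjugate (EFin \o Phi)) (dual_point Phi Om eta x).

Definition fd_run (f Phi : 'rV[R]_d -> R) (eps c : R) (t : nat)
    (x1 : 'rV[R]_d) eta x : Prop :=
  x 1%N = x1 /\
  forall j, performed_step (fd_V f eps c) x t j ->
    admissible Phi (fd_Omega f eps c) (eta j) (x j) /\
    x j.+1 = mirror_step Phi (fd_Omega f eps c) (eta j) (x j).

End Procedure.

(* Main.v *)
(** Writing g for the gradient of f at x and z = x - xstar, the bounds on the
    Hessian give (mu + L) <g, z> >= |g|^2 + mu L |z|^2, so the cosine of the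
    angle between g and z is at least c, while g lies in the ball of radius R(x)
    around m(x).  The factor alpha(x) is the least one for which these two facts
    force <alpha m, z> >= <g, z>, and <g, z> >= f(x) - f(xstar) by convexity.
    Hence D_{f,Omega}(xstar || x) >= 0 off V, which is all that the usual
    telescoping argument for mirror descent needs.  On V one has
    mu |z| <= |g| <= (1 + 1/c) R(x), and R(x) <= L eps sqrt(d) / 2.

    That a step satisfies grad Phi(x_{j+1}) = grad Phi(x_j) - eta_j Omega(x_j)
    is proved directly: for u in the interior of dom Phi^*, the function
    Phi - <u, .> is coercive, hence has a strict minimizer x0, where
    grad Phi(x0) = u; it grows at least linearly away from x0, which shows that
    Phi^* has gradient x0 at u. *)

Require Import Defs.
From mathcomp Require Import all_boot all_order all_algebra.
From mathcomp Require Import all_classical all_reals all_analysis.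
From mathcomp Require Import ring lra.

Set Implicit Arguments.
Unset Strict Implicit.
Unset Printing Implicit Defensive.

Import Order.TTheory GRing.Theory Num.Theory.
Import numFieldNormedType.Exports.

Local Open Scope classical_set_scope.
Local Open Scope ring_scope.

(** * The Euclidean inner product and Cauchy-Schwarz *)

Section EuclideanLemmas.
Context {R : realType} {d : nat}.
Implicit Types (u v w z g : 'rV[R]_d) (a : R).

Lemma dotE u v : dot u v = \sum_i u 0 i * v 0 i.
Proof. by rewrite /dot mxE; apply: eq_bigr => i _; rewrite mxE. Qed.

Lemma dotC u v : dot u v = dot v u.
Proof. by rewrite !dotE; apply: eq_bigr => i _; rewrite mulrC. Qed.

Lemma dotDl u v w : dot (u + v) w = dot u w + dot v w.
Proof. by rewrite /dot mulmxDl mxE. Qed.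

Lemma dotZl a u v : dot (a *: u) v = a * dot u v.
Proof. by rewrite /dot -scalemxAl mxE. Qed.

Lemma dotNl u v : dot (- u) v = - dot u v.
Proof. by rewrite -scaleN1r dotZl mulN1r. Qed.

Lemma dotBl u v w : dot (u - v) w = dot u w - dot v w.
Proof. by rewrite dotDl dotNl. Qed.

Lemma dotDr u v w : dot w (u + v) = dot w u + dot w v.
Proof. by rewrite dotC dotDl !(dotC w). Qed.

Lemma dotZr a u v : dot u (a *: v) = a * dot u v.
Proof. by rewrite dotC dotZl (dotC u). Qed.

Lemma dotNr u v : dot u (- v) = - dot u v.
Proof. by rewrite dotC dotNl (dotC u). Qed.

Lemma dotBr u v w : dot w (u - v) = dot w u - dot w v.
Proof. by rewrite dotDr dotNr. Qed.

Definition dot_linear := (dotDl, dotDr, dotNl, dotNr, dotZl, dotZr).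

Lemma dot0l u : dot 0 u = 0.
Proof. by rewrite -(scale0r u) dotZl mul0r. Qed.

Lemma dot0r u : dot u 0 = 0.
Proof. by rewrite dotC dot0l. Qed.

Lemma dot_delta u i : dot u (delta_mx 0 i) = u 0 i.
Proof.
rewrite dotE (bigD1 i)//= big1 ?addr0 => [|j ji]; rewrite mxE eqxx ?eqxx /=.
  by rewrite mulr1.
by rewrite (negbTE ji) mulr0.
Qed.

Lemma dot_ge0 u : 0 <= dot u u.
Proof. by rewrite dotE; apply: sumr_ge0 => i _; rewrite -expr2 sqr_ge0. Qed.

Lemma dot_eq0 u : dot u u = 0 -> u = 0.
Proof.
rewrite dotE => /eqP; rewrite psumr_eq0 => [|i _]; last first.
  by rewrite -expr2 sqr_ge0.
move=> /allP u0; apply/rowP => i; rewrite mxE; apply/eqP.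
by have := u0 i (mem_index_enum i); rewrite /= mulf_eq0 orbb.
Qed.

Lemma norm2_ge0 u : 0 <= norm2 u.
Proof. exact: sqrtr_ge0. Qed.

Lemma sqr_norm2 u : norm2 u ^+ 2 = dot u u.
Proof. by rewrite sqr_sqrtr// dot_ge0. Qed.

Lemma le_norm2 u v : dot u u <= dot v v -> norm2 u <= norm2 v.
Proof. exact: ler_wsqrtr. Qed.

Lemma CauchySchwarz_dot u v : dot u v ^+ 2 <= dot u u * dot v v.
Proof.
have [v0|v0] := eqVneq (dot v v) 0.
  by rewrite v0 (dot_eq0 v0) dot0r expr0n mulr0.
have v_gt0 : 0 < dot v v by rewrite lt_neqAle eq_sym v0 dot_ge0.
have := dot_ge0 (dot v v *: u - dot u v *: v).
rewrite !dot_linear (dotC v u) => h.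
by rewrite -subr_ge0 -(pmulr_rge0 _ v_gt0); lra.
Qed.

Lemma dot_le_norm2 u v : dot u v <= norm2 u * norm2 v.
Proof.
apply: le_trans (ler_norm _) _.
rewrite -ler_sqr ?nnegrE ?mulr_ge0 ?norm2_ge0//.
by rewrite real_normK ?num_real// exprMn !sqr_norm2 CauchySchwarz_dot.
Qed.

Lemma norm2D u v : norm2 (u + v) <= norm2 u + norm2 v.
Proof.
rewrite -ler_sqr ?nnegrE ?addr_ge0 ?norm2_ge0//.
rewrite sqrrD !sqr_norm2 !dot_linear (dotC v u) mulr2n.
by have := dot_le_norm2 u v; lra.
Qed.

(* The deviation of [dot w z] from its value for vectors parallel to g is
   bounded by Cauchy-Schwarz applied to the components orthogonal to g. *)
Lemma gram_CauchySchwarz g w z : 0 < dot g g ->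
  (dot w z * dot g g - dot w g * dot g z) ^+ 2 <=
  (dot w w * dot g g - dot w g ^+ 2) * (dot z z * dot g g - dot g z ^+ 2).
Proof.
move=> g0.
have := CauchySchwarz_dot (dot g g *: w - dot w g *: g)
                          (dot g g *: z - dot g z *: g).
rewrite !dot_linear (dotC g w) (dotC z g).
set G := dot g g in g0 *; set a := dot w g; set b := dot g z => h.
by rewrite -(ler_pM2l (_ : 0 < G ^+ 2)) ?exprn_gt0//; lra.
Qed.

End EuclideanLemmas.

(** * Plane geometry of angles and discs, then its transfer to any dimension *)

Section AngleConditions.
Context {R : realType}.
Implicit Types (a b c n s al M r x y : R).

Lemma dot2_le a b x y r n : 0 <= r -> 0 <= n ->
  a ^+ 2 + b ^+ 2 <= r ^+ 2 -> x ^+ 2 + y ^+ 2 = n ^+ 2 -> a * x + b * y <= r * n.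
Proof.
move=> r0 n0 ab xy; apply: le_trans (ler_norm _) _.
rewrite -ler_sqr ?nnegrE ?mulr_ge0// real_normK ?num_real//.
rewrite exprMn -xy; apply: le_trans (_ : (a ^+ 2 + b ^+ 2) * (x ^+ 2 + y ^+ 2) <= _).
  by have := sqr_ge0 (a * y - b * x); lra.
by apply: ler_wpM2r ab; rewrite addr_ge0// sqr_ge0.
Qed.

(* In the plane, with m = (M, 0): the points g = (x, y) with y >= 0 from which
   the segment from 0 to al * m is seen under an angle at least pi/2 + asin s
   form a disc segment, and al is the least value for which the corresponding
   disc contains the disc of radius r around m. *)
Lemma disc_in_lens c s al M r x y :
  0 < c -> 0 <= s -> c ^+ 2 + s ^+ 2 = 1 -> 0 <= r -> r < c * M ->
  al * M * (c * M - r) = c * (M ^+ 2 - r ^+ 2) ->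
  (x - M) ^+ 2 + y ^+ 2 <= r ^+ 2 ->
  s * al * M * y <= c * (al * M * x - (x ^+ 2 + y ^+ 2)).
Proof.
move=> c0 s0 cs r0 rcM alE xyr.
(* The conclusion describes the disc with centre (al M / 2, - s al M / (2 c)) and radius al M / (2
   c). After scaling by 2 c, [N0] says that this radius is at least r, and [XY] that the distance
   from the centre to m is the difference of the radii: the disc of radius r around m is internally
   tangent. *)
have N0 : 0 <= al * M - 2 * c * r.
  have k0 : 0 < c * M - r by rewrite subr_gt0.
  rewrite -(pmulr_lge0 _ k0) mulrBl alE.
  have -> : c * (M ^+ 2 - r ^+ 2) - 2 * c * r * (c * M - r) =
            c * ((c * M - r) ^+ 2 + s ^+ 2 * M ^+ 2 + (1 - c ^+ 2 - s ^+ 2) * M ^+ 2).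
    by ring.
  have -> : 1 - c ^+ 2 - s ^+ 2 = 0 by lra.
  apply: mulr_ge0; first exact: ltW.
  by rewrite mul0r addr0 -[_ ^+ 2 * _]exprMn addr_ge0 ?sqr_ge0.
have XY : (2 * c * M - c * al * M) ^+ 2 + (s * al * M) ^+ 2 =
          (al * M - 2 * c * r) ^+ 2.
  apply: subr0_eq.
  have -> : (2 * c * M - c * al * M) ^+ 2 + (s * al * M) ^+ 2
      - (al * M - 2 * c * r) ^+ 2 = (c ^+ 2 + s ^+ 2 - 1) * (al * M) ^+ 2
      + 4 * c * (c * (M ^+ 2 - r ^+ 2) - al * M * (c * M - r)) by ring.
  by rewrite alE cs !subrr mulr0 mul0r addr0.
have h := dot2_le r0 N0 xyr XY.
have h2 := ler_wpM2l (ltW c0) xyr.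
rewrite -subr_ge0.
have -> : c * (al * M * x - (x ^+ 2 + y ^+ 2)) - s * al * M * y =
   (r * (al * M - 2 * c * r) -
     ((x - M) * (2 * c * M - c * al * M) + y * (s * al * M)))
   + (c * r ^+ 2 - c * ((x - M) ^+ 2 + y ^+ 2))
   + (al * M * (c * M - r) - c * (M ^+ 2 - r ^+ 2)) by ring.
by rewrite alE subrr addr0 addr_ge0 // subr_ge0.
Qed.

(** Write c = cos theta and |s| = sin theta. Then w and g make an angle at most pi/2 - theta, and g
    and z one at most theta, so w and z make an angle at most pi/2. The proof compares the
    components orthogonal to g instead of using angles. *)
Lemma angle_triangle d c s (w g z : 'rV[R]_d) :
  0 < c -> c ^+ 2 + s ^+ 2 = 1 -> 0 < dot g g ->
  0 <= dot w g -> s ^+ 2 * (dot w w * dot g g) <= dot w g ^+ 2 ->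
  0 <= dot g z -> c ^+ 2 * (dot g g * dot z z) <= dot g z ^+ 2 ->
  0 <= dot w z.
Proof.
move=> c0 cs g0 wg0 wg gz0 gz; rewrite -(pmulr_lge0 _ g0).
have := gram_CauchySchwarz w z g0; have := CauchySchwarz_dot w g.
move: (dot g g) (dot w g) (dot g z) g0 wg0 wg gz0 gz => G p q g0 wg0 wg gz0 gz.
rewrite -subr_ge0; set W := dot w w * _ - _ => W0; set Z := dot z z * _ - _ => h.
have sW : s ^+ 2 * W <= c ^+ 2 * p ^+ 2.
  have -> : c ^+ 2 = 1 - s ^+ 2 by lra.
  by rewrite /W; lra.
have cZ : c ^+ 2 * Z <= s ^+ 2 * q ^+ 2.
  have -> : s ^+ 2 = 1 - c ^+ 2 by lra.
  by rewrite /Z; lra.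
have c20 : 0 < c ^+ 2 by rewrite exprn_gt0.
have : (dot w z * G - p * q) ^+ 2 <= (p * q) ^+ 2.
  rewrite -(ler_pM2l c20); apply: le_trans (ler_wpM2l (ltW c20) h) _.
  have := ler_wpM2l W0 cZ; have := ler_wpM2r (sqr_ge0 q) sW.
  by lra.
have pq0 : 0 <= p * q by rewrite mulr_ge0.
rewrite -[leLHS]real_normK ?num_real// ler_sqr ?nnegrE// ler_norml.
by move=> /andP[+ _]; lra.
Qed.


(** [angle_triangle] is applied to w = al m - g. Its angle with g is controlled by [disc_in_lens],
    read in the plane spanned by m and g, where g has coordinates <g, m> / |m| along m and T / |m|
    across it. *)
Lemma approx_gradient_dot d c al r (m g z : 'rV[R]_d) :
  0 < c -> c <= 1 -> 0 <= r -> r < c * norm2 m -> norm2 (g - m) <= r ->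
  al * norm2 m * (c * norm2 m - r) = c * (norm2 m ^+ 2 - r ^+ 2) ->
  c * (norm2 g * norm2 z) <= dot g z ->
  dot g z <= dot (al *: m) z.
Proof.
move=> c0 c1 r0 rcM gm alE gz.
have M0 : 0 < norm2 m by rewrite -(pmulr_rgt0 _ c0) (le_lt_trans r0).
have rM : r < norm2 m by rewrite (lt_le_trans rcM)// ler_piMl// ltW.
have al0 : 0 <= al.
  have k0 : 0 < norm2 m * (c * norm2 m - r) by rewrite mulr_gt0// subr_gt0.
  rewrite -(pmulr_lge0 _ k0) mulrA alE mulr_ge0 ?(ltW c0)// subr_ge0.
  by rewrite ler_sqr ?nnegrE// ltW.
have {}gm : dot g g - 2 * dot g m + norm2 m ^+ 2 <= r ^+ 2.
  move: gm; rewrite -ler_sqr ?nnegrE ?norm2_ge0// !sqr_norm2 !dot_linear.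
  by rewrite (dotC m g); lra.
have g0 : 0 < dot g g.
  rewrite lt_neqAle dot_ge0 andbT eq_sym; apply: contraTneq gm => /dot_eq0 ->.
  by rewrite !dot0l mulr0 subrr add0r -ltNge ltr_sqr ?nnegrE// norm2_ge0.
have s2 : 0 <= 1 - c ^+ 2.
  by rewrite subr_ge0 -(expr1n _ 2) ler_sqr ?nnegrE// ltW.
pose s := Num.sqrt (1 - c ^+ 2).
have sE : s ^+ 2 = 1 - c ^+ 2 by rewrite sqr_sqrtr.
have cs : c ^+ 2 + s ^+ 2 = 1 by rewrite sE; lra.
have T2 : 0 <= norm2 m ^+ 2 * dot g g - dot g m ^+ 2.
  by rewrite subr_ge0 sqr_norm2 mulrC CauchySchwarz_dot.
pose T := Num.sqrt (norm2 m ^+ 2 * dot g g - dot g m ^+ 2).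
have TE : T ^+ 2 = norm2 m ^+ 2 * dot g g - dot g m ^+ 2 by rewrite sqr_sqrtr.
have xyE : (dot g m / norm2 m) ^+ 2 + (T / norm2 m) ^+ 2 = dot g g.
  by rewrite !expr_div_n TE; field; rewrite gt_eqF.
have lens : s * al * T <= c * (al * dot g m - dot g g).
  have := @disc_in_lens c s al (norm2 m) r (dot g m / norm2 m) (T / norm2 m)
     c0 (sqrtr_ge0 _) cs r0 rcM alE.
  rewrite xyE.
  have -> : s * al * norm2 m * (T / norm2 m) = s * al * T.
    by field; rewrite gt_eqF.
  have -> : al * norm2 m * (dot g m / norm2 m) = al * dot g m.
    by field; rewrite gt_eqF.
  apply; apply: le_trans gm.
  have -> : (dot g m / norm2 m - norm2 m) ^+ 2 + (T / norm2 m) ^+ 2 =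
    (dot g m / norm2 m) ^+ 2 + (T / norm2 m) ^+ 2 - 2 * dot g m + norm2 m ^+ 2.
    by field; rewrite gt_eqF.
  by rewrite xyE.
have lens0 : 0 <= s * al * T by rewrite !mulr_ge0 ?sqrtr_ge0.
rewrite -subr_ge0 -dotBl.
apply: (angle_triangle (g := g) c0 cs) => //.
- by rewrite dotBl dotZl (dotC m) -(pmulr_rge0 _ c0) (le_trans lens0).
(* The square (al T)^2 is the Gram determinant of al m - g and g, since adding multiples of g does
   not change it; replacing c^2 by 1 - s^2 then gives the cosine condition. *)
- have : (s * al * T) ^+ 2 <= (c * (al * dot g m - dot g g)) ^+ 2.
    by rewrite ler_sqr ?nnegrE// (le_trans lens0).
  rewrite !exprMn TE sqr_norm2 !dot_linear (dotC m g) sE; lra.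
- by rewrite (le_trans _ gz)// mulr_ge0 ?(ltW c0)// mulr_ge0 ?norm2_ge0.
- rewrite -!sqr_norm2 -!exprMn ler_sqr// nnegrE ?mulr_ge0 ?norm2_ge0 ?(ltW c0)//.
  by rewrite (le_trans _ gz)// mulr_ge0 ?(ltW c0)// mulr_ge0 ?norm2_ge0.
Qed.
End AngleConditions.

(** * Derivatives along lines *)

Section LineCalculus.
Context {R : realType} {d : nat}.
Implicit Types (f : 'rV[R]_d -> R) (x y v w z : 'rV[R]_d).

Lemma derive_grad f x v : differentiable f x -> 'D_v f x = dot (grad f x) v.
Proof.
move=> df; rewrite deriveE// {1}(row_sum_delta v) linear_sum dotE /=.
by apply: eq_bigr => i _; rewrite linearZ mxE deriveE// mulrC.
Qed.

Lemma is_derive_line (W : normedModType R) (F : 'rV[R]_d -> W) x v (s : R) :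
  derivable F (x + s *: v) v ->
  is_derive s 1 (fun r : R => F (x + r *: v)) ('D_v F (x + s *: v)).
Proof.
have E : (fun h : R => h^-1 *: (((fun r : R => F (x + r *: v)) \o shift s) (h *: 1)
            - F (x + s *: v)))
       = (fun h : R => h^-1 *: ((F \o shift (x + s *: v)) (h *: v) - F (x + s *: v))).
  by apply/funext => h /=; rewrite [h *: 1]mulr1 scalerDl addrCA.
by move=> Fv; split; rewrite /derivable /derive E.
Qed.

Lemma is_derive_grad_line f x v (s : R) :
  differentiable f (x + s *: v) ->
  is_derive s 1 (fun r : R => f (x + r *: v)) (dot (grad f (x + s *: v)) v).
Proof.
move=> df; rewrite -derive_grad//; apply: is_derive_line.
exact: diff_derivable.
Qed.

Lemma is_derive_grad_dot f x v w (s : R) :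
  differentiable (grad f) (x + s *: v) ->
  is_derive s 1 (fun r : R => dot (grad f (x + r *: v)) w)
    (dot (v *m hessian f (x + s *: v)) w).
Proof.
move=> df; rewrite /hessian -deriveEjacobian//.
have dG : derivable (grad f) (x + s *: v) v by exact: diff_derivable.
rewrite derive_mx// (_ : (fun r => _) =
  \sum_i (fun r : R => w 0 i * grad f (x + r *: v) 0 i)); last first.
  by apply/funext => r; rewrite fct_sumE dotE; apply: eq_bigr => i _; rewrite mulrC.
rewrite dotE; apply: is_derive_eq.
  apply: is_derive_sum => i.
  apply: (@is_deriveZ _ _ _ (fun r : R => grad f (x + r *: v) 0 i) (w 0 i)).
  apply: (@is_derive_line _ (fun y => grad f y 0 i)).
  exact: (derivable_mxP _ _ _).1.
by apply: eq_bigr => i _; rewrite !mxE mulrC.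
Qed.

End LineCalculus.

(** * Consequences of the Hessian bounds *)

Section SmoothStronglyConvex.
Context {R : realType} {d : nat}.
Implicit Types (x y v w z h : 'rV[R]_d).

Lemma MVT01 (k dk : R -> R) : (forall s : R, is_derive s 1 k (dk s)) ->
  exists s : R, [/\ 0 < s, s < 1 & k 1 - k 0 = dk s].
Proof.
move=> kdk; have kc : {within `[0, 1], continuous k}.
  by apply: derivable_within_continuous => s _; case: (kdk s).
have [s + kE] := MVT ltr01 (fun s _ => kdk s) kc.
rewrite in_itv/= => /andP[s0 s1]; exists s; split=> //.
by rewrite kE subr0 mulr1.
Qed.

Variables (mu L : R) (f : 'rV[R]_d -> R).
Hypothesis f_C2 : C2 f.
Hypothesis f_hessian : forall y,
  loewner_le mu%:M (hessian f y) /\ loewner_le (hessian f y) L%:M.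

Lemma grad_line_bounds x v :
  mu * dot v v <= dot (grad f (x + v) - grad f x) v <= L * dot v v.
Proof.
have [_ dg _] := f_C2.
have [s [_ _]] := MVT01 (fun s => @is_derive_grad_dot _ _ f x v v s (dg _)).
rewrite scale1r scale0r addr0 -dotBl => ->.
have [/(_ v) + /(_ v)] := f_hessian (x + s *: v).
rewrite !mul_mx_scalar -!scalemxAl.
have scE a : (a *: (v *m v^T)) 0 0 = a * dot v v by rewrite mxE.
rewrite !scE.
by rewrite -/(dot (v *m hessian f (x + s *: v)) v) => -> ->.
Qed.

Lemma quadratic_bounds x v :
  mu / 2 * dot v v <= f (x + v) - f x - dot (grad f x) v <= L / 2 * dot v v.
Proof.
have [df _ _] := f_C2.
have quad (a b s : R) : is_derive s 1 (fun r : R => a * r + b * r ^+ 2) (a + 2 * b * s).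
  rewrite (_ : (fun _ => _) = a \*: id + b \*: (id ^+ 2)); last by apply/funext.
  apply: is_derive_eq.
  by rewrite /GRing.scale/= expr1; ring.
have dk (b s : R) : is_derive s 1
   (fun r : R => f (x + r *: v) - (dot (grad f x) v * r + b * r ^+ 2))
   (dot (grad f (x + s *: v) - grad f x) v - 2 * b * s).
  rewrite dotBl -addrA -opprD.
  exact: is_deriveB (is_derive_grad_line (df _)) (quad _ _ _).
have dkE (s : R) : s * dot (grad f (x + s *: v) - grad f x) v
    = dot (grad f (x + s *: v) - grad f x) (s *: v).
  by rewrite dotZr.
apply/andP; split.
- have [s [s0 s1]] := MVT01 (dk (mu / 2 * dot v v)).
  have /andP[+ _] := grad_line_bounds x (s *: v).
  rewrite -dkE !dot_linear scale1r scale0r addr0 => h1 h2.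
  (* The gradient bound is used for the displacement s v, so it controls s times the derivative; the
     factor s > 0 is then cancelled. *)
  have : 0 <= s * (dot (grad f (x + s *: v)) v - dot (grad f x) v - mu * dot v v * s).
    by lra.
  by rewrite pmulr_rge0// => h3; lra.
- have [s [s0 s1]] := MVT01 (dk (L / 2 * dot v v)).
  have /andP[_] := grad_line_bounds x (s *: v).
  rewrite -dkE !dot_linear scale1r scale0r addr0 => h1 h2.
  have : 0 <= s * (L * dot v v * s - (dot (grad f (x + s *: v)) v - dot (grad f x) v)).
    by lra.
  by rewrite pmulr_rge0// => h3; lra.
Qed.

(* f (x - h) lies between the quadratic lower model at y and the upper model at
   x, and f (y + h) between the lower model at x and the upper model at y; adding
   the two inequalities removes the values of f. *)
Lemma grad_interpolation x y h :
  2 * dot (grad f x - grad f y - mu *: (x - y)) h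
    + mu * dot (x - y) (x - y) - (L - mu) * dot h h
  <= dot (grad f x - grad f y) (x - y).
Proof.
have /andP[_ U1] := quadratic_bounds x (- h).
have /andP[L1 _] := quadratic_bounds y (x - h - y).
have /andP[_ U2] := quadratic_bounds y h.
have /andP[L2 _] := quadratic_bounds x (y + h - x).
move: U1 L1 U2 L2; rewrite [y + (_ - _)]addrC [x + (_ - _)]addrC !subrK.
rewrite !dot_linear (dotC h x) (dotC h y) (dotC y x).
by lra.
Qed.

(** With g and z the differences of gradients and of points, the interpolation inequality is
    optimized over h along u = g - mu z; the resulting bound on |u|^2 rearranges to the claim. *)
Lemma grad_cocoercive x y : mu <= L ->
  dot (grad f x - grad f y) (grad f x - grad f y)
    + mu * L * dot (x - y) (x - y)
  <= (mu + L) * dot (grad f x - grad f y) (x - y).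
Proof.
move=> muL; have := grad_interpolation x y.
move: (grad f x - grad f y) (x - y) => g z interp.
set u := g - mu *: z.
have interpZ (tau : R) : (2 * tau - (L - mu) * tau ^+ 2) * dot u u
    <= dot g z - mu * dot z z.
  by have := interp (tau *: u); rewrite -/u dotZr !dotZl !dotZr; lra.
have : dot u u <= (L - mu) * (dot g z - mu * dot z z).
  (* If L = mu the quadratic term in tau vanishes, so a nonzero u is refuted by a tau for which 2
     tau |u|^2 exceeds the right-hand side by 1. *)
  have [LE|neq] := eqVneq L mu.
    rewrite LE subrr mul0r leNgt; apply/negP => u0.
    have := interpZ ((dot g z - mu * dot z z + 1) / (2 * dot u u)).
    rewrite LE subrr mul0r subr0 [2 * _]mulrC -mulrA divfK ?gt_eqF ?mulr_gt0//.
    by lra.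
  have k0 : 0 < L - mu by rewrite subr_gt0 lt_neqAle eq_sym neq.
  (* This tau maximizes 2 tau - (L - mu) tau^2. *)
  have := interpZ (L - mu)^-1.
  rewrite -(ler_pM2l k0); apply: le_trans.
  rewrite le_eqVlt; apply/orP; left; apply/eqP; field.
  by rewrite gt_eqF.
rewrite /u !dot_linear (dotC z g); lra.
Qed.

End SmoothStronglyConvex.

(** F - <u, .> is minimal at x, so its derivative vanishes there along every coordinate line. The
    case u = 0 is the first-order condition at a minimizer. *)
Lemma subgradient_unique {R : realType} {d : nat} (F : 'rV[R]_d -> R) x u :
  (forall y, differentiable F y) -> (forall y, dot u (y - x) <= F y - F x) ->
  grad F x = u.
Proof.
move=> dF Fu; apply/rowP => i.
have lin (a s : R) : is_derive s 1 (fun r : R => a * r) a.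
  rewrite (_ : (fun _ => _) = a \*: id)//; apply: is_derive_eq.
  by rewrite [_ *: _]mulr1.
pose k (s : R) := F (x + s *: delta_mx 0 i) - u 0 i * s.
have dk (s : R) : is_derive s 1 k
    (dot (grad F (x + s *: delta_mx 0 i)) (delta_mx 0 i) - u 0 i).
  exact: is_deriveB (is_derive_grad_line (dF _)) (lin _ _).
have dk0 : is_derive (0 : R) 1 k 0.
  apply: (@derive1_at_min R k (-1) 1 0).
  - by rewrite lerN10 || lra.
  - by move=> s _; case: (dk s).
  - by rewrite in_itv/= ltrN10 ltr01.
  - move=> s _; have := Fu (x + s *: delta_mx 0 i).
    rewrite addrAC subrr add0r dotZr dot_delta /k scale0r addr0 mulr0.
    by lra.
have := dk 0; case=> _; case: dk0 => _ -> /esym/eqP.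
by rewrite scale0r addr0 dot_delta subr_eq0 => /eqP.
Qed.

(** * Finite differences as gradient estimates *)

Section FiniteDifferenceGradient.
Context {R : realType} {d : nat}.
Variables (mu L eps : R) (f : 'rV[R]_d -> R).
Implicit Types (x z : 'rV[R]_d).
Hypothesis mu_gt0 : 0 < mu.
Hypothesis mu_le_L : mu <= L.
Hypothesis eps_gt0 : 0 < eps.
Hypothesis f_C2 : C2 f.
Hypothesis f_hessian : forall y,
  loewner_le mu%:M (hessian f y) /\ loewner_le (hessian f y) L%:M.

Let L_gt0 : 0 < L. Proof. exact: lt_le_trans mu_le_L. Qed.

(** The Taylor remainders of f at x + eps e_i and x - eps e_i lie between 0 and L eps^2 / 2. Divided
    by eps, they are r_i - (g_i - m_i) and r_i + (g_i - m_i), where g is the gradient. *)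
Lemma fd_coord x i :
  `|grad f x 0 i - fd_m f eps x 0 i| <= fd_r f eps x 0 i <= L * eps / 2.
Proof.
have /andP[] := quadratic_bounds f_C2 f_hessian x (eps *: delta_mx 0 i).
have /andP[] := quadratic_bounds f_C2 f_hessian x (- (eps *: delta_mx 0 i)).
rewrite !dot_linear !dot_delta mxE !eqxx /= !mulr1 !opprK.
set g := grad f x 0 i.
have e0 : eps != 0 by rewrite gt_eqF.
set a := f (x - _); set b := f (x + _) => a1 a2 b1 b2.
have mu0 : 0 <= mu / 2 * (eps * eps).
  by apply/ltW; rewrite mulr_gt0 ?divr_gt0 ?mulr_gt0.
have e20 : 0 < 2 * eps by rewrite mulr_gt0.
rewrite /fd_r /fd_m !mxE -/a -/b; apply/andP; split.
  rewrite ler_norml; apply/andP; split.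
    rewrite -subr_ge0 (_ : _ - _ = (a - f x + eps * g) / eps).
      by rewrite divr_ge0 ?(ltW eps_gt0)//; lra.
    by field.
  rewrite -subr_ge0 (_ : _ - _ = (b - f x - eps * g) / eps).
    by rewrite divr_ge0 ?(ltW eps_gt0)//; lra.
  by field.
by rewrite ler_pdivrMr//; lra.
Qed.

Lemma norm2_grad_fd_m x : norm2 (grad f x - fd_m f eps x) <= fd_R f eps x.
Proof.
apply: le_norm2; rewrite !dotE; apply: ler_sum => i _.
have /andP[+ _] := fd_coord x i; rewrite -!expr2 => h.
have -> : (grad f x - fd_m f eps x) 0 i = grad f x 0 i - fd_m f eps x 0 i.
  by rewrite !mxE.
rewrite -[leLHS]real_normK ?num_real// ler_sqr ?nnegrE//.
exact: le_trans h.
Qed.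

Lemma fd_R_le x : fd_R f eps x <= L * eps / 2 * Num.sqrt d%:R.
Proof.
have k0 : 0 <= L * eps / 2 by rewrite divr_ge0// mulr_ge0// ltW.
rewrite -ler_sqr ?nnegrE ?norm2_ge0 ?(mulr_ge0 k0) ?sqrtr_ge0//.
rewrite sqr_norm2 exprMn sqr_sqrtr ?ler0n// dotE.
rewrite mulr_natr -[X in _ *+ X]card_ord -sumr_const; apply: ler_sum => i _.
have /andP[h h2] := fd_coord x i.
by rewrite -expr2 ler_sqr ?nnegrE// (le_trans _ h).
Qed.

Lemma strong_monotone_norm2 x y :
  mu * norm2 (x - y) <= norm2 (grad f x - grad f y).
Proof.
have [z0|z0] := eqVneq (norm2 (x - y)) 0; first by rewrite z0 mulr0 norm2_ge0.
have z_gt0 : 0 < norm2 (x - y) by rewrite lt_neqAle eq_sym z0 norm2_ge0.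
rewrite -(ler_pM2r z_gt0) -mulrA -expr2 sqr_norm2.
apply: le_trans (dot_le_norm2 _ _).
have /andP[+ _] := grad_line_bounds f_C2 f_hessian y (x - y).
by rewrite [y + _]addrC subrK.
Qed.

Let c := 2 * Num.sqrt (mu * L) / (mu + L).

Let sum_gt0 : 0 < mu + L. Proof. exact: addr_gt0. Qed.

Let sqr_sqrt_muL : Num.sqrt (mu * L) ^+ 2 = mu * L.
Proof. by rewrite sqr_sqrtr// mulr_ge0// ltW. Qed.

Lemma fd_c_gt0 : 0 < c.
Proof. by rewrite divr_gt0// mulr_gt0// sqrtr_gt0 mulr_gt0. Qed.

Lemma fd_c_le1 : c <= 1.
Proof.
rewrite ler_pdivrMr// mul1r -ler_sqr ?nnegrE ?mulr_ge0 ?sqrtr_ge0 ?(ltW sum_gt0)//.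
by rewrite exprMn sqr_sqrt_muL; have := sqr_ge0 (mu - L); lra.
Qed.

(** Cocoercivity combined with a^2 + q^2 b^2 >= 2 q a b for q = sqrt (mu L), which is where the
    value of [c] comes from. *)
Lemma grad_angle x y : c * (norm2 (grad f x - grad f y) * norm2 (x - y)) <=
  dot (grad f x - grad f y) (x - y).
Proof.
rewrite -(ler_pM2l sum_gt0) mulrA [_ * c]mulrC divfK ?gt_eqF//.
apply: le_trans (grad_cocoercive f_C2 f_hessian x y mu_le_L).
rewrite -!sqr_norm2; set a := norm2 _; set b := norm2 _.
set q := Num.sqrt _; have -> : mu * L = q ^+ 2 by rewrite sqr_sqrt_muL.
by have := sqr_ge0 (a - q * b); lra.
Qed.

Variable xstar : 'rV[R]_d.
Hypothesis xstar_min : is_minimizer f xstar.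

Let grad_xstar : grad f xstar = 0.
Proof.
have [df _ _] := f_C2; apply: subgradient_unique => // y.
by rewrite dot0l subr_ge0.
Qed.

Lemma fd_V_near x : fd_V f eps c x ->
  norm2 (x - xstar) <= L / (2 * mu) * (1 + c^-1) * eps * Num.sqrt d%:R.
Proof.
move=> Vx; have := strong_monotone_norm2 x xstar; rewrite grad_xstar subr0 => mono.
have gM : norm2 (grad f x) <= fd_R f eps x + fd_M f eps x.
  rewrite -[grad f x](subrK (fd_m f eps x)); apply: le_trans (norm2D _ _) _.
  by rewrite lerD2r norm2_grad_fd_m.
have c1 : 0 <= 1 + c^-1 by rewrite addr_ge0// invr_ge0 ltW// fd_c_gt0.
rewrite -(ler_pM2l mu_gt0); apply: le_trans (mono) _; apply: le_trans (gM) _.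
apply: le_trans (_ : (1 + c^-1) * fd_R f eps x <= _).
  by rewrite mulrDl mul1r lerD2l mulrC.
have := ler_wpM2l c1 (fd_R_le x).
have -> : mu * (L / (2 * mu) * (1 + c^-1) * eps * Num.sqrt d%:R) =
   (1 + c^-1) * (L * eps / 2 * Num.sqrt d%:R).
  by field; rewrite gt_eqF ?fd_c_gt0// gt_eqF.
by [].
Qed.

Lemma fd_Omega_gap x : ~ fd_V f eps c x ->
  f x - f xstar <= dot (fd_Omega f eps c x) (x - xstar).
Proof.
rewrite /fd_V /= => /negP; rewrite -ltNge ltr_pdivrMr ?fd_c_gt0// => RM.
apply: (@le_trans _ _ (dot (grad f x) (x - xstar))).
  have /andP[+ _] := quadratic_bounds f_C2 f_hessian x (xstar - x).
  rewrite [x + _]addrC subrK -[xstar - x]opprB !dotNr dotNl opprK.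
  have : 0 <= mu / 2 * dot (x - xstar) (x - xstar).
    by rewrite !mulr_ge0 ?dot_ge0// ltW.
  by lra.
have R0 : 0 <= fd_R f eps x by exact: norm2_ge0.
have M0 : 0 < fd_M f eps x.
  by rewrite -(pmulr_lgt0 _ fd_c_gt0) (le_lt_trans R0).
have RM0 : 0 < c * fd_M f eps x - fd_R f eps x by rewrite subr_gt0 mulrC.
apply: (@approx_gradient_dot _ _ c _ (fd_R f eps x)) => //.
- exact: fd_c_gt0.
- exact: fd_c_le1.
- by rewrite mulrC.
- exact: norm2_grad_fd_m.
- rewrite -/(fd_M f eps x) /fd_alpha; field.
  by rewrite !gt_eqF.
- by have := grad_angle x xstar; rewrite grad_xstar subr0.
Qed.

End FiniteDifferenceGradient.

(** * Continuity and compactness for the Euclidean norm *)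

Section DotTopology.
Context {R : realType} {d : nat}.
Implicit Types (u x y : 'rV[R]_d).

Lemma dot_continuous u : continuous (dot u).
Proof.
rewrite (_ : dot u = fun y => \sum_i u 0 i * y 0 i); last first.
  by apply/funext => y; rewrite dotE.
apply: continuous_big => [|i _ x /=]; first exact: add_continuous.
by apply: continuousM; [exact: cst_continuous|exact: coord_continuous].
Qed.

Lemma dot_sub_continuous u : continuous (fun y => dot (y - u) (y - u)).
Proof.
rewrite (_ : (fun y => _) =
    fun y => \sum_i (y 0 i - u 0 i) * (y 0 i - u 0 i)); last first.
  by apply/funext => y; rewrite dotE; apply: eq_bigr => i _; rewrite !mxE.
apply: continuous_big => [|i _ x /=]; first exact: add_continuous.
have c : {for x, continuous (fun y : 'rV[R]_d => y 0 i - u 0 i)}.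
  by apply: continuousB; [exact: coord_continuous|exact: cst_continuous].
exact: (continuousM c c).
Qed.

Lemma compact_box (K : 'I_d -> R) :
  compact [set x : 'rV[R]_d | forall i, `|x 0 i| <= K i].
Proof.
rewrite (_ : mkset _ = [set x : 'rV[R]_d | forall i, `[- K i, K i]%classic (x ord0 i)]).
  by apply: (@rV_compact _ _ (fun i => `[- K i, K i]%classic)) => i;
    exact: segment_compact.
apply/seteqP; split => x /= xK i; first by rewrite in_itv/= -ler_norml.
by have := xK i; rewrite /= in_itv/= -ler_norml.
Qed.

Lemma coord_le_norm2 x i : `|x 0 i| <= norm2 x.
Proof.
rewrite -ler_sqr ?nnegrE ?norm2_ge0// sqr_norm2 real_normK ?num_real//.
rewrite dotE (bigD1 i)//= -expr2 lerDl.
by apply: sumr_ge0 => j _; rewrite -expr2 sqr_ge0.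
Qed.

(** A Euclidean ball lies in a coordinate box, which is compact as a product of segments. *)
Lemma compact_in_ball2 (A : set 'rV[R]_d) a r :
  closed A -> (forall y, A y -> norm2 (y - a) <= r) -> compact A.
Proof.
move=> cA Ar; have cB := @compact_box (fun i => `|a 0 i| + r).
apply: (subclosed_compact cA cB).
move=> y /Ar yr i /=.
have -> : y 0 i = a 0 i + (y - a) 0 i by rewrite !mxE; ring.
by rewrite (le_trans (ler_normD _ _))// lerD2l (le_trans _ yr)// coord_le_norm2.
Qed.

Lemma norm2Z (t : R) x : 0 <= t -> norm2 (t *: x) = t * norm2 x.
Proof.
move=> t0; rewrite /norm2 dotZl dotZr mulrA -expr2 sqrtrM ?sqr_ge0//.
by rewrite sqrtr_sqr ger0_norm.
Qed.

Lemma norm2_continuous a : continuous (fun y => norm2 (y - a)).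
Proof.
move=> x; apply: (@continuous_comp _ _ _ (fun y => dot (y - a) (y - a)) Num.sqrt).
  exact: dot_sub_continuous.
exact: sqrt_continuous.
Qed.

Lemma compact_ball2 a r : compact [set y : 'rV[R]_d | norm2 (y - a) <= r].
Proof.
apply: (compact_in_ball2 (a := a) (r := r)) => //.
exact: ((continuous_closedP _).1 (@norm2_continuous a) _ (@closed_le _ r)).
Qed.

Lemma compact_sphere2 a r : compact [set y : 'rV[R]_d | norm2 (y - a) = r].
Proof.
apply: (compact_in_ball2 (a := a) (r := r)) => [|y /= ->//].
exact: ((continuous_closedP _).1 (@norm2_continuous a) _ (@closed_eq _ r)).
Qed.

End DotTopology.

(** * Real-valued Legendre functions and the gradient of the conjugate *)

Section FiniteLegendre.
Context {R : realType} {d : nat}.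
Variable Phi : 'rV[R]_d -> R.
Hypothesis Phi_legendre : legendre (EFin \o Phi).
Implicit Types (u x y v : 'rV[R]_d).

Local Notation Phis := (conjugate (EFin \o Phi)).

Lemma legendre_differentiable x : differentiable Phi x.
Proof.
have [_ [_ dPhi _] _] := Phi_legendre.
have : differentiable (fine \o (EFin \o Phi)) x.
  apply: dPhi; rewrite (_ : dom _ = setT) ?interiorT//.
  by apply/seteqP; split=> // y _; exact: ltry.
by [].
Qed.

Lemma legendre_convex x y (t : R) : 0 <= t -> t <= 1 ->
  Phi (t *: x + (1 - t) *: y) <= t * Phi x + (1 - t) * Phi y.
Proof.
move=> t0 t1; have [[_ cPhi _] _ _] := Phi_legendre.
have t01 : Itv.spec (Itv.num_sem (R:=R)) (Itv.Real `[0%Z, 1%Z]) t.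
  by rewrite /= /Itv.num_sem/= num_real in_itv/= t0 t1.
have := cPhi (x, Phi x) (y, Phi y) (Itv.mk t01).
rewrite !inE /epigraph/= => /(_ (lexx _) (lexx _)).
by rewrite lee_fin.
Qed.

Lemma legendre_gradient_le x y : dot (grad Phi x) (y - x) <= Phi y - Phi x.
Proof.
have dx := legendre_differentiable x.
rewrite -derive_grad// leNgt; apply/negP => lt.
(* Otherwise some difference quotient with step 0 < h <= 1 would exceed Phi y - Phi x, against
   convexity on the segment. *)
have /cvgr_gt/(_ _ lt)[e /= e0 he] := @diff_derivable _ _ _ _ _ (y - x) dx.
pose h := Num.min (e / 2) 1.
have h0 : 0 < h by rewrite lt_min ltr01 andbT divr_gt0.
have h1 : h <= 1 by rewrite ge_min lexx orbT.
have he2 : h < e by rewrite gt_min; apply/orP; left; lra.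
have := he h; rewrite /ball_/= sub0r normrN gtr0_norm// gt_eqF// => /(_ he2 isT).
rewrite [_ *: _]mulrC ltr_pdivlMr//.
have := legendre_convex y x (ltW h0) h1.
have -> : h *: y + (1 - h) *: x = h *: (y - x) + x.
  by rewrite scalerBl scale1r scalerBr addrA addrAC.
by lra.
Qed.

(** The gradient is a subgradient at every point, so essential strict convexity can be used on the
    whole space. *)
Lemma legendre_midpoint x y : x != y ->
  Phi (2^-1 *: x + 2^-1 *: y) < (Phi x + Phi y) / 2.
Proof.
move=> xy; have [_ _ sPhi] := Phi_legendre.
have cT : convex_set [set: 'rV[R]_d] by move=> a b l _ _; rewrite inE.
have subT : [set: 'rV[R]_d] `<=` [set x | subdifferential (EFin \o Phi) x !=set0].
  move=> z _; exists (grad Phi z) => w /=; rewrite -EFinD lee_fin.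
  by rewrite -lerBrDl legendre_gradient_le.
have h12 : (0 : R) < 2^-1 < (1 : R).
  by rewrite invr_gt0 ltr0n invf_lt1 ?ltr0n ?ltr1n.
have := sPhi _ cT subT x y 2^-1 I I xy h12.
rewrite -!EFinM -EFinD lte_fin.
have -> : 1 - 2^-1 = 2^-1 :> R by lra.
by lra.
Qed.

(** The conjugate at u is minus the infimum of [h u]. *)
Let h u x := Phi x - dot u x.

Let h_continuous u : continuous (h u).
Proof.
move=> x; apply: (@continuousB _ _ _ Phi (dot u)).
  exact/differentiable_continuous/legendre_differentiable.
exact: dot_continuous.
Qed.

Lemma conjugate_lt_pinfty u : dom Phis u -> exists C, forall x, dot u x - Phi x <= C.
Proof.
move=> uy; have uN : (-oo < Phis u)%E.
  apply: (lt_le_trans (ltNyr (dot u 0 - Phi 0))).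
  by apply: ereal_sup_ubound; exists 0.
exists (fine (Phis u)) => x; rewrite -lee_fin fineK; last first.
  by rewrite fin_numE gt_eqF// lt_eqF.
by apply: ereal_sup_ubound; exists x.
Qed.

Lemma legendre_attained u : (dom Phis)° u ->
  exists x0, forall y, y != x0 -> h u x0 < h u y.
Proof.
move=> /nbhs_ballP[e /= e0 ue].
(* Coercivity: finiteness of the conjugate at u + (e/2) e_i and u - (e/2) e_i bounds the i-th
   coordinate on the sublevel set of [h u] through 0. A minimizer over the resulting box is
   therefore global. *)
have HK i : exists k, forall x, h u x <= h u 0 -> `|x 0 i| <= k.
  have bnd (s : R) : `|s| < e ->
      exists C, forall x, dot (u + s *: delta_mx 0 i) x - Phi x <= C.
    move=> se; apply: conjugate_lt_pinfty; apply: ue; split=> // a b.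
    rewrite (ord1 a) !mxE !eqxx/= /ball/= opprD addNKr normrN.
    by case: eqVneq => _; rewrite ?mulr1// mulr0 normr0.
  have e2 : `|e / 2| < e by rewrite gtr0_norm ?divr_gt0//; lra.
  have e2' : `|- (e / 2)| < e by rewrite normrN.
  have [C1 H1] := bnd _ e2; have [C2 H2] := bnd _ e2'.
  exists ((`|C1| + `|C2| + h u 0) / (e / 2)) => x hx.
  rewrite ler_pdivlMr ?divr_gt0//.
  have := H1 x; have := H2 x; rewrite !dotDl !dotZl !(dotC _ x) !dot_delta.
  rewrite (dotC x u); move: hx; rewrite /h.
  have := ler_norm C1; have := ler_norm C2; have := normr_ge0 C1; have := normr_ge0 C2.
  by case: (ger0P (x 0 i)) => _; lra.
have {HK}[K HK] := choice HK.
have K0 : [set x : 'rV[R]_d | forall i, `|x 0 i| <= K i] !=set0.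
  by exists 0 => i /=; apply: HK.
have hc : {within [set x : 'rV[R]_d | forall i, `|x 0 i| <= K i], continuous (h u)}.
  exact/continuous_subspaceT/h_continuous.
have [x0 _ x0min] := EVT_min_rV K0 (@compact_box _ _ K) hc.
have {}x0min y : h u x0 <= h u y.
  have [yK|/existsNP[i yK]] := pselect (forall i, `|y 0 i| <= K i).
    by apply: x0min; rewrite inE.
  apply: (@le_trans _ _ (h u 0)); last by rewrite leNgt; apply/negP => /ltW /HK.
  by apply: x0min; rewrite inE => j; exact: HK.
exists x0 => y yx0; rewrite lt_neqAle x0min andbT; apply/negP => /eqP hE.
have := x0min (2^-1 *: y + 2^-1 *: x0); have := legendre_midpoint yx0.
by move: hE; rewrite /h !dot_linear; lra.
Qed.

(* Convexity turns the strict minimum over a sphere into linear growth. *)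
Lemma legendre_growth u x0 (rho : R) : 0 < rho ->
  (forall y, y != x0 -> h u x0 < h u y) ->
  exists2 kap, 0 < kap & forall y, rho <= norm2 (y - x0) ->
    kap * norm2 (y - x0) <= h u y - h u x0.
Proof.
move=> rho0 x0min.
pose S := [set y : 'rV[R]_d | norm2 (y - x0) = rho].
(* The sphere is empty only in dimension 0; any y at distance at least rho would project radially
   onto it. *)
have [[p Sp]|S0] := pselect (S !=set0); last first.
  exists 1 => // y rhoy; exfalso; apply: S0.
  have n0 : 0 < norm2 (y - x0) by exact: lt_le_trans rhoy.
  exists (x0 + (rho / norm2 (y - x0)) *: (y - x0)).
  by rewrite /S /= addrAC subrr add0r norm2Z ?divfK ?gt_eqF// divr_ge0 ?ltW.
have hc : {within S, continuous (h u)}.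
  exact/continuous_subspaceT/h_continuous.
have [q qS qmin] := EVT_min_rV (ex_intro _ p Sp) (@compact_sphere2 _ _ x0 rho) hc.
have kap0 : 0 < h u q - h u x0.
  rewrite subr_gt0 x0min//; apply/eqP => qx0.
  by move: qS rho0; rewrite qx0 inE /S/= subrr /norm2 dot0l sqrtr0 => <-; rewrite ltxx.
exists ((h u q - h u x0) / rho) => [|y rhoy]; first by rewrite divr_gt0.
have n0 : 0 < norm2 (y - x0) by exact: lt_le_trans rhoy.
(* With this t, the point t y + (1 - t) x0 is the radial projection of y onto the sphere. *)
pose t := rho / norm2 (y - x0).
have t0 : 0 <= t by rewrite divr_ge0// ltW.
have t1 : t <= 1 by rewrite ler_pdivrMr// mul1r.
have : h u q <= h u (t *: y + (1 - t) *: x0).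
  apply: qmin; rewrite inE /S/=.
  have -> : t *: y + (1 - t) *: x0 - x0 = t *: (y - x0).
    by rewrite scalerBl scale1r scalerBr addrCA addrAC subrr add0r.
  by rewrite norm2Z// divfK// gt_eqF.
have := legendre_convex y x0 t0 t1; rewrite /h !dot_linear => cv qle.
have : h u q - h u x0 <= t * (h u y - h u x0) by rewrite /h; lra.
have -> : (h u q - h u x0) / rho * norm2 (y - x0) = (h u q - h u x0) / t.
  by rewrite /t; field; rewrite !gt_eqF.
by rewrite ler_pdivrMr ?divr_gt0// mulrC.
Qed.

(** Testing the supremum at x0 gives the lower bound. For the upper one, a point within rho of x0
    gains at most rho |s|, and for farther points the linear growth of [h u] outweighs the gain
    because |s| <= kap. *)
Lemma conjugate_expansion u x0 (rho : R) i : 0 < rho ->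
  (forall y, y != x0 -> h u x0 < h u y) ->
  exists2 kap, 0 < kap & forall s, `|s| <= kap ->
    0 <= fine (Phis (u + s *: delta_mx 0 i)) + h u x0 - s * x0 0 i <= rho * `|s|.
Proof.
move=> rho0 x0min; have [kap kap0 growth] := legendre_growth rho0 x0min.
exists kap => // s skap.
have x0le y : h u x0 <= h u y.
  by have [->//|/x0min/ltW] := eqVneq y x0.
set w := u + s *: delta_mx 0 i.
have wE y : dot w y - Phi y = - h u y + s * y 0 i.
  by rewrite /w /h dotDl dotZl (dotC _ y) (dotC _ y) dot_delta (dotC y u); ring.
have lo : ((- h u x0 + s * x0 0 i)%:E <= Phis w)%E.
  by apply: ereal_sup_ubound; exists x0 => //=; rewrite -EFinB wE.
have up : (Phis w <= (- h u x0 + s * x0 0 i + rho * `|s|)%:E)%E.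
  apply: ge_ereal_sup => _ [y _ <-] /=; rewrite -EFinB lee_fin wE.
  set n := norm2 (y - x0).
  have n0 : 0 <= n by exact: norm2_ge0.
  have sn : s * y 0 i - s * x0 0 i <= `|s| * n.
    rewrite -mulrBr (le_trans (ler_norm _))// normrM ler_wpM2l//.
    by have := coord_le_norm2 (y - x0) i; rewrite !mxE.
  have [yrho|/ltW yrho] := leP rho n.
    have := growth y yrho; have := ler_wpM2r n0 skap.
    have : 0 <= rho * `|s| by rewrite mulr_ge0// ltW.
    by rewrite -/n; lra.
  have := ler_wpM2l (normr_ge0 s) yrho; have := x0le y.
  by lra.
have fin : Phis w \is a fin_num.
  rewrite fin_numElt (lt_le_trans (ltNyr _) lo).
  by rewrite (le_lt_trans up (ltry _)).
move: lo up; rewrite -(fineK fin) !lee_fin => lo up.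
by apply/andP; split; lra.
Qed.

Lemma legendre_grad_conjugate u : (dom Phis)° u ->
  grad Phi (grad (fine \o Phis) u) = u.
Proof.
move=> /legendre_attained[x0 x0min].
suff -> : grad (fine \o Phis) u = x0.
  apply: subgradient_unique; first exact: legendre_differentiable.
  move=> y; have [->|/x0min] := eqVneq y x0; first by rewrite !subrr dot0r.
  by rewrite /h dotBr; lra.
(* Taking rho to be the tolerance e in [conjugate_expansion] puts the i-th difference quotient at u
   within e of the i-th coordinate of x0. *)
apply/rowP => i; rewrite mxE; apply: cvg_lim => //.
apply/cvgrPdist_le => e e0.
have [kap kap0 expand] := conjugate_expansion i e0 x0min.
have PhisE : fine (Phis u) = - h u x0.
  have := expand 0; rewrite normr0 scale0r addr0 mul0r mulr0 subr0 => /(_ (ltW kap0)).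
  by rewrite -eq_le eq_sym addr_eq0 => /eqP.
near=> s.
have s0 : s != 0 by near: s; exact: nbhs_dnbhs_neq.
have /expand : `|s| <= kap by near: s; exact: dnbhs0_le.
rewrite /= PhisE addrC [s *: _ + u]addrC.
set c := fine _ => /andP[lo up].
rewrite -(ler_pM2l (_ : 0 < `|s|)) ?normr_gt0// -normrM mulrBr.
rewrite [s^-1 *: _]/(s^-1 * _) mulVKf//.
by rewrite ler_norml; apply/andP; split; lra.
Unshelve. all: by end_near. Qed.

End FiniteLegendre.

(** * One mirror descent step *)

Section MirrorDescent.
Context {R : realType} {d : nat}.
Implicit Types (f Phi : 'rV[R]_d -> R) (Om : 'rV[R]_d -> 'rV[R]_d).
Implicit Types (w x y : 'rV[R]_d).

Lemma bregman_refl Phi x : bregman Phi x x = 0.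
Proof. by rewrite /bregman !subrr dot0r subr0. Qed.

Lemma bregman_legendre_ge0 Phi x y :
  legendre (EFin \o Phi) -> 0 <= bregman Phi x y.
Proof. by move=> Phi_leg; rewrite /bregman subr_ge0 legendre_gradient_le. Qed.

(** The three-point identity eta <Om x, y - w> = D(w || x) - D(w || y) - D(y || x), added to the
    step condition. The choice w = x gives descent, and w = xstar gives progress towards the
    minimizer. *)
Lemma mirror_descent_step f Phi Om (eta : R) x y w :
  grad Phi y = grad Phi x - eta *: Om x ->
  eta * div_with f Om y x <= bregman Phi y x ->
  eta * (f y - f w) <= bregman Phi w x - bregman Phi w y
    - eta * (dot (Om x) (x - w) - (f x - f w)).
Proof. by move=> gE; rewrite /bregman /div_with gE !dot_linear; lra. Qed.

End MirrorDescent.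

(** * The stopping rule, then the convergence bound *)

Lemma stops_byPn {R : realType} d (V : set 'rV[R]_d) x t :
  reflect (forall j, (1 <= j <= t)%N -> ~ V (x j)) (~~ stops_by V x t).
Proof.
apply: (iffP hasPn) => /= H j.
  move=> jt; rewrite -(notin_setE V); apply: H; rewrite mem_iota add1n ltnS.
  by [].
by rewrite mem_iota add1n ltnS => /H; rewrite notin_setE.
Qed.

Lemma returned_point_in {R : realType} d (V : set 'rV[R]_d) x t :
  stops_by V x t -> V (returned_point V x t).
Proof.
rewrite /stops_by has_filter /returned_point.
case E : [seq _ <- _ | _] => [//|j s] _ /=.
have : j \in [seq j <- iota 1 t | x j \in V] by rewrite E mem_head.
by rewrite mem_filter => /andP[/set_mem].
Qed.

(** Without a stop the filtered list is empty and [head] yields its default [t]. *)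
Lemma returned_point_last {R : realType} d (V : set 'rV[R]_d) x t :
  ~~ stops_by V x t -> returned_point V x t = x t.
Proof. by rewrite /stops_by has_filter negbK /returned_point => /eqP ->. Qed.

Theorem corollary6p2 (R : realType) (d : nat) (mu L : R)
    (f : 'rV[R]_d -> R) (xstar : 'rV[R]_d) (eps : R)
    (Phi : 'rV[R]_d -> R) (t : nat)
    (x1 : 'rV[R]_d) (eta : nat -> R) (x : nat -> 'rV[R]_d)
    (c := 2 * Num.sqrt (mu * L) / (mu + L))
    (V := fd_V f eps c) (Omega := fd_Omega f eps c) :
  0 < mu -> mu <= L ->
  C2 f ->
  convex_function [set: 'rV[R]_d] f ->
  (forall y, loewner_le mu%:M (hessian f y) /\
             loewner_le (hessian f y) L%:M) ->
  is_minimizer f xstar ->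
  0 < eps ->
  legendre (EFin \o Phi) ->
  (2 <= t)%N ->
  fd_run f Phi eps c t x1 eta x ->
  (forall j, performed_step V x t j ->
     eta j * div_with f Omega (x j.+1) (x j) <= bregman Phi (x j.+1) (x j)) ->
  exists B : R,
    is_max_over
      [set y | norm2 (y - xstar) <=
               L / (2 * mu) * (1 + c^-1) * eps * Num.sqrt d%:R]
      (fun y => f y - f xstar) B /\
    f (returned_point V x t) - f xstar <=
      if stops_by V x t then B
      else Num.max (bregman Phi xstar x1 / \sum_(1 <= j < t) eta j) B.
Proof.
move=> mu0 muL fC2 _ fH xmin e0 leg t2 [x1E run] steps.
have L0 : 0 < L by exact: lt_le_trans muL.
have c0 : 0 < c by exact: fd_c_gt0.
pose r := L / (2 * mu) * (1 + c^-1) * eps * Num.sqrt d%:R.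
have r0 : 0 <= r.
  rewrite !mulr_ge0 ?sqrtr_ge0 ?(ltW e0) ?(ltW L0)// ?addr_ge0 ?invr_ge0 ?(ltW c0)//.
  by rewrite mulr_ge0 ?(ltW mu0).
pose D := [set y : 'rV[R]_d | norm2 (y - xstar) <= r].
have D0 : D !=set0 by exists xstar; rewrite /D /= subrr /norm2 dot0l sqrtr0.
have fc : {within D, continuous f}.
  apply: continuous_subspaceT => y; have [df _ _] := fC2.
  exact/differentiable_continuous.
(* The maximum over the ball is attained, by continuity and compactness. *)
have [b bD bmax] := EVT_max_rV D0 (@compact_ball2 _ _ xstar r) fc.
exists (f b - f xstar); split.
  split; first by exists b; [exact: set_mem|].
  by move=> y yD; rewrite lerD2r bmax// inE.
case: ifPn => [stop|nstop].
  rewrite lerD2r bmax// inE /D /=.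
  exact: (fd_V_near mu0 muL e0 fC2 fH xmin (returned_point_in stop)).
rewrite (returned_point_last nstop) le_max; apply/orP; left.
have outV := stops_byPn _ _ _ nstop.
have performed j : (1 <= j < t)%N -> performed_step V x t j.
  move=> jt; split=> //; apply/stops_byPn => i /andP[i1 ij].
  have /andP[_ jt'] := jt.
  by apply: outV; rewrite i1 (leq_trans ij)// ltnW.
have step j w : (1 <= j < t)%N -> [/\ 0 < eta j &
    eta j * (f (x j.+1) - f w) <= bregman Phi w (x j) - bregman Phi w (x j.+1)
      - eta j * (dot (Omega (x j)) (x j - w) - (f (x j) - f w))].
  move=> /performed pj; have [[eta0 adm] xE] := run j pj; split=> //.
  apply: mirror_descent_step (steps j pj).
  by rewrite xE /mirror_step legendre_grad_conjugate.
(* Telescoped bound after n steps, which lead to x_{n+1}. Weighting its gap, the last one, by all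
   stepsizes is possible because f decreases along the iterates; the sign of the sum is carried
   along to multiply that decrease. *)
have main n : (n < t)%N ->
  [/\ 0 <= \sum_(1 <= j < n.+1) eta j &
    (\sum_(1 <= j < n.+1) eta j) * (f (x n.+1) - f xstar)
    + bregman Phi xstar (x n.+1) <= bregman Phi xstar x1].
  elim: n => [_|n IHn nt]; first by rewrite big_geq// mul0r add0r x1E.
  have [S0 IH] := IHn (ltnW nt).
  rewrite big_nat_recr//=.
  have n1t : (1 <= n.+1 < t)%N by [].
  (* For w the current iterate, the correction term and D(w || w) vanish, which leaves the decrease
     of f. *)
  have [eta0 desc] := step _ (x n.+1) n1t.
  have [_ prog] := step _ xstar n1t.
  have gap := fd_Omega_gap mu0 muL e0 fC2 fH xmin (outV n.+1 (ltnW nt)).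
  have {}desc : f (x n.+2) <= f (x n.+1).
    rewrite -subr_le0 -(pmulr_rle0 _ eta0) (le_trans desc)//.
    rewrite bregman_refl !subrr dot0r subrr mulr0 subr0 sub0r oppr_le0.
    exact: bregman_legendre_ge0.
  split; first by rewrite addr_ge0// ltW.
  have : eta n.+1 * (f (x n.+1) - f xstar) <=
      eta n.+1 * dot (Omega (x n.+1)) (x n.+1 - xstar).
    by rewrite ler_pM2l.
  by have := ler_wpM2l S0 desc; lra.
have tE : t.-1.+1 = t by rewrite prednK// ltnW.
have [_] := main t.-1 (eq_leq tE); rewrite tE.
(* Since t >= 2 at least one step is performed, and its positive stepsize makes the division
   legitimate. *)
have Spos : 0 < \sum_(1 <= j < t) eta j.
  have [m mE] : exists m, t = m.+2 by exists t.-2; case: (t) t2 => [|[]].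
  rewrite mE in main step *; rewrite big_nat_recr//= ltr_wpDl//.
    by have [] := main m (leqnSn _).
  by have [] := step m.+1 xstar (ltnSn _).
rewrite ler_pdivlMr// mulrC.
by have := bregman_legendre_ge0 xstar (x t) leg; lra.
Qed.
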